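(* The number of isomorphism classes of $2$-reductive medial quandles of order $n$ is at most $2^{(\frac14+o(1))n^2}$.
   Context: A quandle is a non-empty set $Q$ with a binary operation such that for all $x,y,z$: $xx=x$; $x(yz)=(xy)(xz)$; and $xu=y$ has a unique solution $u\in Q$. Its order is $|Q|$. It is medial if $(xy)(uv)=(xu)(yv)$ for all $x,y,u,v\in Q$, and $2$-reductive if $(xy)y=y$ for all $x,y\in Q$. The asymptotic notation refers to $n\to\infty$. *)

(* Defs.v *)
From mathcomp Require Import all_boot.
From mathcomp Require Import boolp.

Set Implicit Arguments.
Unset Strict Implicit.
Unset Printing Implicit Defensive.

Section Quandles.
Variables (Q : Type) (op : Q -> Q -> Q).

Record is_quandle : Prop := IsQuandle {
  quandle_nonempty : inhabited Q;
  quandle_idem : forall x, op x x = x;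
  quandle_ldistr : forall x y z, op x (op y z) = op (op x y) (op x z);
  quandle_ldiv : forall x y, exists! u, op x u = y
}.

Definition is_medial : Prop :=
  forall x y u v, op (op x y) (op u v) = op (op x u) (op y v).

Definition is_2reductive : Prop := forall x y, op (op x y) y = y.

End Quandles.

Definition magma_iso (P Q : Type) (opP : P -> P -> P) (opQ : Q -> Q -> Q) : Prop :=
  exists2 f : P -> Q, bijective f & forall x y, f (opP x y) = opQ (f x) (f y).

(* Every structure of order n is isomorphic to one carried by 'I_n, so the
   isomorphism classes of order n are counted on multiplication tables. *)
Definition mul_table (n : nat) := {ffun 'I_n -> {ffun 'I_n -> 'I_n}}.

Definition table_op n (t : mul_table n) (x y : 'I_n) : 'I_n := t x y.

Definition medial_quandles_2red (n : nat) : {set mul_table n} :=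
  [set t : mul_table n | `[< [/\ is_quandle (table_op t),
                                 is_medial (table_op t)
                               & is_2reductive (table_op t)] >]].

Definition table_iso n : rel (mul_table n) :=
  fun s t => `[< magma_iso (table_op s) (table_op t) >].

Definition num_2red_medial_quandles (n : nat) : nat :=
  #|equivalence_partition (@table_iso n) (medial_quandles_2red n)|.

(* Main.v *)
Require Import Defs.
From mathcomp Require Import all_boot all_fingroup.
From mathcomp Require Import boolp zify.

Set Implicit Arguments.
Unset Strict Implicit.
Unset Printing Implicit Defensive.

(** Isomorphism classes are bounded by labelled tables: the factor [n!] lost in
    this way is swallowed by the error term in the exponent, so no isomorphism
    ever has to be built.

    In a 2-reductive medial quandle the left translations commute with each
    other, and [x] and [y # x] induce the same translation
    ([mulCA], [mul_orbit_const]).  So the group [G] generated by the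
    translations is abelian, the translation of [x] depends only on the
    [G]-orbit of [x], and it is known on a whole orbit once its value at a
    single base point and the action of [G] on that orbit are known.

    The action of [G] on one orbit is cheap to record.  By Lagrange,
    at most [log2 a] of the translations are enough to be transitive on an orbit
    of size [a] ([gen_few_over]).  One map [g i] of the whole set to
    itself can carry the [i]-th chosen generator of every orbit at the same
    time, so [log2 n] such maps, together with the map [p] from points to base
    points, are enough, and there are only [2 ^ o(n ^ 2)] choices of these data.

    Given [p] and [g], the table is determined by the elements [t x y] with [x]
    and [y] base points ([shift_set_inj]).  Such an element is either the base
    point [y] itself or a non-base point, and a non-base point reveals the [y]
    it comes from, as the base point of its own orbit.  So it is enough to know
    a relation between base points and non-base points.  With [k] orbits there
    are [2 ^ (k * (n - k))] such relations, at most [2 ^ (n ^ 2 / 4)]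
    ([card_framed]); this is where the constant 1/4 comes from. *)

(** * Left translations of 2-reductive medial quandles *)

Section TwoReductive.
Variables (Q : Type) (op : Q -> Q -> Q).
Hypotheses (quandleQ : is_quandle op) (medQ : is_medial op).
Local Notation "x # y" := (op x y) (at level 40, left associativity).

Lemma quandle_mul_inj x : injective (op x).
Proof.
move=> u v euv; have [w [_ uniq_w]] := quandle_ldiv quandleQ x (x # u).
by rewrite -(uniq_w u erefl) (uniq_w v (esym euv)).
Qed.

(** The division-free form of the commutation of the displacements
    [L_x L_u^-1] and [L_y L_u^-1]: with [L_u p = L_y v] and [L_u q = L_x v], it
    reads [L_x L_u^-1 L_y v = L_y L_u^-1 L_x v]. *)
Lemma medial_dis_comm x y u v p q :
  u # p = y # v -> u # q = x # v -> x # p = y # q.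
Proof.
move=> eup euq; apply: (@quandle_mul_inj (x # u)).
by rewrite -(quandle_ldistr quandleQ) eup (quandle_ldistr quandleQ) -euq medQ.
Qed.

Hypothesis redQ : is_2reductive op.

(** By 2-reductivity the displacement [L_(w # z) L_z^-1] fixes [z].  It commutes
    with [L_y L_z^-1], hence also fixes [y # z].  Taking [w = y] first shows that
    [L_z] fixes [y # z], and then [w = x] gives the result. *)
Lemma mul_fixes_orbit x y z : (x # z) # (y # z) = y # z.
Proof.
have [p [ep _]] := quandle_ldiv quandleQ z (y # z).
have zz := quandle_idem quandleQ z.
have Ep w : (w # z) # p = y # z.
  by apply: (@medial_dis_comm _ _ z z p z) => //; rewrite redQ zz.
suff eq_p : p = y # z by have := Ep x; rewrite eq_p.
by apply: (@quandle_mul_inj (y # z)); rewrite Ep (quandle_idem quandleQ).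
Qed.

Lemma mul_orbit_const x y z : (x # y) # z = y # z.
Proof.
by rewrite -[z in LHS](quandle_idem quandleQ) medQ mul_fixes_orbit.
Qed.

Lemma mulCA x y z : x # (y # z) = y # (x # z).
Proof. by rewrite (quandle_ldistr quandleQ) mul_orbit_const. Qed.

End TwoReductive.

(** * Few generators *)

(** Each generator outside the group reached so far at least doubles it. *)
Lemma gen_few_over (gT : finGroupType) (K : {group gT}) (X : {set gT}) :
  exists s : seq gT, [/\ {subset s <= X},
    <<K :|: [set x in s]>>%g = <<K :|: X>>%g
    & 2 ^ size s <= #|<<K :|: X>> : K|%g].
Proof.
have [k] := ubnP #|<<K :|: X>> : K|%g.
elim: k K => // k IHk K; rewrite ltnS => leGk.
have sKG : K \subset <<K :|: X>>%g by rewrite sub_gen ?subsetUl.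
have [sXK | /subsetPn[x Xx notKx]] := boolP (X \subset K).
  exists [::]; split=> //; last by rewrite expn0 indexg_gt0.
  have -> : [set x in [::]] = set0 :> {set gT} by apply/setP=> x; rewrite !inE.
  by rewrite setU0 (setUidPl sXK).
pose K1 := (K <*> <[x]>)%G.
have sKK1 : K \subset K1 by rewrite joing_subl.
have K1x : x \in K1 by rewrite (subsetP (joing_subr _ _)) ?cycle_id.
have lt1K1 : 1 < #|K1 : K|%g.
  by rewrite indexg_gt1; apply: contra notKx => /subsetP; apply.
have joinK1 (A : {set gT}) : <<K1 :|: A>>%g = <<K :|: (x |: A)>>%g.
  apply/eqP; rewrite eqEsubset !gen_subG !subUset join_subG cycle_subG sub1set.
  have -> : K \subset <<K :|: (x |: A)>>%g by rewrite sub_gen ?subsetUl.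
  have -> : x \in <<K :|: (x |: A)>>%g by rewrite mem_gen // !inE eqxx orbT.
  have -> : x \in <<K1 :|: A>>%g by rewrite mem_gen // inE K1x.
  have -> : K \subset <<K1 :|: A>>%g.
    by rewrite sub_gen // (subset_trans sKK1) ?subsetUl.
  by rewrite !sub_gen // ?subsetUr // setUA subsetUr.
have eqG : <<K1 :|: X>>%g = <<K :|: X>>%g.
  by rewrite joinK1 [_ |: _](setUidPr _) ?sub1set.
have sK1G : K1 \subset <<K :|: X>>%g by rewrite -eqG sub_gen ?subsetUl.
have indexM := Lagrange_index sK1G sKK1.
have [|s [sX gens les]] := IHk K1.
  rewrite eqG; apply: leq_trans leGk; rewrite -indexM.
  by rewrite ltn_Pmulr ?indexg_gt0.
exists (x :: s); split.
- by move=> y; rewrite inE => /predU1P[-> | /sX].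
- rewrite -eqG -gens joinK1; congr <<_ :|: _>>%g.
  by apply/setP=> y; rewrite !inE.
by rewrite expnS mulnC -indexM; move: les; rewrite eqG => les; apply: leq_mul.
Qed.

(** * Tables with a prescribed frame *)

Section Code.
Variable T : finType.
Implicit Types (t : {ffun T -> {ffun T -> T}}) (p : {ffun T -> T}).

(** A frame consists of the base point [p y] of the orbit of each [y], and of maps
    [g i] acting on each orbit as chosen generators of the translation group.
    Transitivity is expressed as an induction principle, which only involves
    [p] and [g], so that it can be applied to two tables at once. *)
Record frame t (m : nat) p (g : {ffun 'I_m -> {ffun T -> T}}) : Prop := Frame {
  frame_idem : forall y, p (p y) = p y;
  frame_mull : forall x y, t (p x) y = t x y;
  frame_mulr : forall x y, p (t x y) = p y;
  frame_comm : forall i x y, g i (t x y) = t x (g i y);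
  frame_gen : forall (A : {set T}) y, p y \in A ->
    (forall i z, z \in A -> g i z \in A) -> y \in A
}.

Definition base p := [set y | p y == y].

(** The relation of base points [x] to the non-base points [t x y], for [y] a base
    point; the second coordinate need not remember [y], since it lies in the
    orbit of [y]. *)
Definition shift_set p t : {set T * T} :=
  [set u in setX (base p) (~: base p) | u.2 \in [set t u.1 y | y in base p]].

Lemma shift_setP p t m g x y z : @frame t m p g ->
    x \in base p -> y \in base p -> z \notin base p -> p z = y ->
  ((x, z) \in shift_set p t) = (t x y == z).
Proof.
move=> tF bx by_ bz pz; rewrite !inE /=.
move: bx by_ bz; rewrite !inE => -> yy ->; rewrite /=.
apply/imsetP/eqP=> [[w] | <-]; last by exists y; rewrite ?inE.
rewrite inE => /eqP ww ez; rewrite ez -pz ez (frame_mulr tF) ww //.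
Qed.

(** The points where [t1 x] and [t2 x] agree are stable under the maps [g i], which
    commute with both; so agreement at the base points propagates along the
    orbits. *)
Lemma shift_set_inj m p g t1 t2 : @frame t1 m p g -> @frame t2 m p g ->
  shift_set p t1 = shift_set p t2 -> t1 = t2.
Proof.
move=> F1 F2 e12.
have eq_base x y : x \in base p -> y \in base p -> t1 x y = t2 x y.
  move=> bx by_; have /eqP yy : p y == y by rewrite inE in by_.
  have [b1 | nb1] := boolP (t1 x y \in base p); last first.
    have pz : p (t1 x y) = y by rewrite (frame_mulr F1).
    apply/esym/eqP; rewrite -(shift_setP F2 bx by_ nb1 pz) -e12.
    by rewrite (shift_setP F1 bx by_ nb1 pz).
  have [b2 | nb2] := boolP (t2 x y \in base p); last first.
    have pz : p (t2 x y) = y by rewrite (frame_mulr F2).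
    apply/eqP; rewrite -(shift_setP F1 bx by_ nb2 pz) e12.
    by rewrite (shift_setP F2 bx by_ nb2 pz).
  move: b1 b2; rewrite !inE => /eqP <- /eqP <-.
  by rewrite (frame_mulr F1) (frame_mulr F2).
have pbase y : p y \in base p by rewrite inE (frame_idem F1).
apply/ffunP=> x; apply/ffunP=> y.
rewrite -(frame_mull F1) -(frame_mull F2).
suff: y \in [set z | t1 (p x) z == t2 (p x) z] by rewrite inE => /eqP.
apply: (frame_gen F1) => [|i z]; rewrite !inE; first by rewrite eq_base.
by move=> /eqP ez; rewrite -(frame_comm F1) -(frame_comm F2) ez.
Qed.

Lemma card_framed m p g :
  #|[set t | `[< @frame t m p g >]]| <= 2 ^ (#|T| ^ 2 %/ 4).
Proof.
set F := [set t | _].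
have injF : {in F &, injective (shift_set p)}.
  move=> t1 t2; rewrite !inE => /asboolP F1 /asboolP F2.
  exact: shift_set_inj F1 F2.
rewrite -(card_in_imset injF).
apply: leq_trans (_ : #|powerset (setX (base p) (~: base p))| <= _).
  apply/subset_leq_card/subsetP=> _ /imsetP[t _ ->].
  by rewrite inE; apply/subsetP=> u; rewrite inE => /andP[].
rewrite card_powerset cardsX leq_exp2l // leq_divRL // mulnC.
(* [k * (n - k) <= n ^ 2 / 4], for [k] base points *)
by rewrite -(cardsC (base p)) nat_AGM2.
Qed.

End Code.

(** * Every 2-reductive medial quandle has a small frame *)

Section Framing.
Variables (n : nat) (t : mul_table n).
Hypotheses (quandle_t : is_quandle (table_op t)) (med_t : is_medial (table_op t)).
Hypothesis (red_t : is_2reductive (table_op t)).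

Let lmul x : {perm 'I_n} := perm (@quandle_mul_inj _ _ quandle_t x).
Let X := [set lmul x | x : 'I_n].
Let G := <<X>>%G.

Let lmulE x y : lmul x y = t x y. Proof. by rewrite permE. Qed.

Let lmul_in_G x : lmul x \in G.
Proof. by rewrite mem_gen // imset_f. Qed.

Let abelG : abelian G.
Proof.
rewrite abelian_gen; apply/centsP=> _ /imsetP[x _ ->] _ /imsetP[y _ ->].
by apply/permP=> z; rewrite !permM !lmulE; apply: (mulCA quandle_t).
Qed.

Let orb := orbit 'P G.
Let p := [ffun y => odflt y [pick z in orb y]].

Let p_orb y : p y \in orb y.
Proof.
rewrite ffunE; case: pickP => [z // | /(_ y)].
by rewrite /= orbit_refl.
Qed.

Let p_eq x y : x \in orb y -> p x = p y.
Proof.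
move=> xy; have e : orb x = orb y by apply/orbit_eqP.
rewrite !ffunE e; case: pickP => // /(_ y).
by rewrite /= orbit_refl.
Qed.

(** The generators of the orbit of [e] are chosen over the stabiliser of [e], whose
    index is the size of the orbit.  As [G] is abelian, this stabiliser fixes
    the orbit pointwise, so the chosen translations alone are transitive on
    it. *)
Lemma framing_exists :
  exists u : {ffun 'I_n -> 'I_n} *
             {ffun 'I_(trunc_log 2 n) -> {ffun 'I_n -> 'I_n}},
    frame t u.1 u.2.
Proof.
have gens e : exists s : seq {perm 'I_n}, [/\ {subset s <= X},
    <<'C_G[e | 'P] :|: [set x in s]>>%g = G & size s <= trunc_log 2 n].
  have [s [sX gen_s le_s]] := gen_few_over 'C_G[e | 'P]%G X.
  have genG : <<'C_G[e | 'P] :|: X>>%g = G.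
    apply/eqP; rewrite eqEsubset gen_subG subUset subsetIl subset_gen.
    by rewrite genS ?subsetUr.
  exists s; split; rewrite ?gen_s //.
  apply: trunc_log_max => //; apply: leq_trans le_s _.
  by rewrite /= genG -card_orbit -[n in _ <= n]card_ord max_card.
have /choice[s sP] := gens.
(* Orbits with fewer generators are padded with the identity. *)
pose g := [ffun i : 'I_(trunc_log 2 n) =>
  [ffun y => nth 1%g (s (p y)) i y]].
have gE i y : g i y = nth 1%g (s (p y)) i y by rewrite ffunE ffunE.
have s_in_G y i : nth 1%g (s y) i \in G.
  have [sX _ _] := sP y; have [lti | gei] := ltnP i (size (s y)).
    by rewrite mem_gen // sX ?mem_nth.
  by rewrite nth_default // group1.
have mul_orb h y : h \in G -> h y \in orb y.
  by move=> Gh; apply: (mem_orbit 'P).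
have G_orb h x y : h \in G -> (h x \in orb y) = (x \in orb y).
  by move=> Gh; apply: (orbit_actr 'P).
have comm_G h1 h2 y : h1 \in G -> h2 \in G -> h1 (h2 y) = h2 (h1 y).
  by move=> G1 G2; rewrite -!permM (centsP abelG).
exists (p, g); split=> /=.
- by move=> y; apply: p_eq.
- move=> x y.
  have NG : G \subset 'N([set z | lmul z == lmul x] | 'P)%g.
    rewrite gen_subG; apply/subsetP=> _ /imsetP[w _ ->]; apply/astabsP=> z.
    rewrite !inE /= /aperm lmulE; congr (_ == _); apply/permP=> v.
    by rewrite !lmulE; apply: (mul_orbit_const quandle_t).
  have /orbitP[h Gh <-] := p_orb x.
  have /astabsP/(_ x) := subsetP NG h Gh.
  by rewrite !inE eqxx -!lmulE => /eqP ->.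
- by move=> x y; rewrite -lmulE; apply/p_eq/mul_orb.
- move=> i x y; rewrite !gE -!lmulE (p_eq (mul_orb _ _ (lmul_in_G x))).
  exact: comm_G.
move=> A y Apy gA.
(* [A] is cut down to one orbit because [g i] is the translation by a generator
   of the orbit of [y] only there. *)
pose B := A :&: orb y.
have pyB z : z \in orb y -> p z = p y by apply: p_eq.
have [sX gen_s le_s] := sP (p y).
have NG : G \subset 'N(B | 'P)%g.
  rewrite -gen_s gen_subG subUset; apply/andP; split.
    apply/subsetP=> h /setIP[Gh /astab1P hpy]; apply/astabsP=> z.
    have [zo|zo] := boolP (z \in orb y).
      suff hz : h z = z by rewrite /= /aperm hz.
      have : z \in orb (p y).
        have /orbit_eqP e : y \in orb (p y) by rewrite orbit_sym p_orb.
        by rewrite /orb -e.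
      case/orbitP=> k Gk <-; rewrite /= /aperm comm_G //.
      by congr (k _); apply: hpy.
    by rewrite !inE /= /aperm G_orb // (negPf zo) !andbF.
  apply/subsetP=> h; rewrite inE => sh.
  have Gh : h \in G by rewrite mem_gen ?sX.
  rewrite !inE /=; apply/subsetP=> z /setIP[Az zo].
  rewrite !inE /= /aperm G_orb // zo andbT.
  have lt_h : index h (s (p y)) < trunc_log 2 n.
    by rewrite (leq_trans _ le_s) // index_mem.
  have := gA (Ordinal lt_h) z Az.
  by rewrite gE (pyB z zo) nth_index.
have /orbitP[h Gh <-] : y \in orb (p y) by rewrite orbit_sym p_orb.
have /astabsP/(_ (p y)) := subsetP NG h Gh.
by rewrite !inE Apy p_orb /= => /andP[].
Qed.
End Framing.

(** * Counting *)

Lemma card_medial_quandles_2red n :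
  #|medial_quandles_2red n| <=
    2 ^ ((trunc_log 2 n).+1 ^ 2 * n + n ^ 2 %/ 4).
Proof.
set m := trunc_log 2 n.
pose U := ({ffun 'I_n -> 'I_n} * {ffun 'I_m -> {ffun 'I_n -> 'I_n}})%type.
have cardU : #|{: U}| <= 2 ^ (m.+1 ^ 2 * n).
  rewrite card_prod !card_ffun !card_ord -expnM -expnD -mulnS.
  apply: leq_trans (_ : (2 ^ m.+1) ^ (n * m.+1) <= _).
    have [-> // | nm_gt0] := posnP (n * m.+1).
    by rewrite leq_exp2r // ltnW // trunc_log_ltn.
  by rewrite -expnM leq_exp2l // mulnCA mulnC.
have sub_frames : medial_quandles_2red n \subset
    \bigcup_(u : U) [set t | `[< frame t u.1 u.2 >]].
  apply/subsetP=> t; rewrite inE => /asboolP[quandle_t med_t red_t].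
  have [u tu] := framing_exists quandle_t med_t red_t.
  by apply/bigcupP; exists u => //; rewrite inE; apply/asboolP.
apply: leq_trans (subset_leq_card sub_frames) _.
apply: leq_trans (_ : \sum_(u : U) 2 ^ (n ^ 2 %/ 4) <= _).
  elim/big_rec2: _ => [|u k A _ leAk]; first by rewrite cards0.
  rewrite (leq_trans (leq_card_setU _ _)) // leq_add //.
  by have := card_framed u.1 u.2; rewrite card_ord.
by rewrite sum_nat_const expnD leq_mul2r cardU orbT.
Qed.

Lemma num_2red_medial_quandles_le n :
  num_2red_medial_quandles n <=
    2 ^ ((trunc_log 2 n).+1 ^ 2 * n + n ^ 2 %/ 4).
Proof.
exact: leq_trans (leq_imset_card _ _) (card_medial_quandles_2red n).
Qed.

(** With [m] the logarithm of [n], this bounds the error term [m.+1 ^ 2 / n] by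
    [8 / m.+1]: an exponent above 2 is what makes the bound tend to 0. *)
Lemma expn3_le m : m.+1 ^ 3 <= 8 * 2 ^ m.
Proof.
elim: m => [//|m IHm].
have [le3m | lt_m3] := leqP 3 m; last by case: m lt_m3 {IHm} => [|[|[|]]].
rewrite [2 ^ _]expnS mulnCA; apply: leq_trans (leq_mul (leqnn 2) IHm).
rewrite !expnS !expn0; nia.
Qed.

From mathcomp Require Import all_order all_algebra.
From mathcomp Require Import all_classical all_reals all_analysis.
Import Order.TTheory GRing.Theory Num.Theory.
Import numFieldNormedType.Exports.
Local Open Scope classical_set_scope.
Local Open Scope ring_scope.

Lemma cvg_log2_sqr_div (R : realType) :
  ((trunc_log 2 n).+1 ^ 2)%:R / n%:R @[n --> \oo] --> (0 : R).
Proof.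
have log_oo : trunc_log 2 n @[n --> \oo] --> \oo.
  move=> A [k _ kA]; exists (2 ^ k)%N => // n /= le_kn.
  by apply: kA; rewrite /= trunc_log_max.
have harm : 8 * harmonic (trunc_log 2 n) @[n --> \oo] --> (0 : R).
  rewrite -[X in _ --> X](mulr0 8); apply: cvgMr.
  exact: (cvg_comp _ _ log_oo (@cvg_harmonic R)).
apply: (@squeeze_cvgr _ _ _ _ (fun=> 0) _ _ _ _ _ harm); last exact: cvg_cst.
near=> n; rewrite divr_ge0 ?ler0n //=.
have n_gt0 : (0 < n)%N by near: n; exists 1%N.
rewrite /harmonic ler_pdivrMr ?ltr0n // mulrAC ler_pdivlMr ?ltr0n //.
rewrite -!natrM ler_nat -expnSr.
apply: leq_trans (expn3_le _) _.
by rewrite leq_mul2l trunc_logP.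
Unshelve. all: by end_near. Qed.

Theorem theorem8p2 (R : realType) :
  exists e : nat -> R,
    (e n @[n --> \oo] --> 0) /\
    forall n : nat,
      (num_2red_medial_quandles n)%:R <= 2 `^ ((1 / 4 + e n) * n%:R ^+ 2).
Proof.
(* [e n * n ^ 2] bounds the number of bits that describe a frame. *)
exists (fun n => ((trunc_log 2 n).+1 ^ 2)%:R / n%:R).
split=> [|n]; first exact: cvg_log2_sqr_div.
have := num_2red_medial_quandles_le n; rewrite -(ler_nat R) => /le_trans-> //.
rewrite natrX -powR_mulrn ?ler0n // ler_powR ?ler1n //.
rewrite natrD addrC mulrDl; apply: lerD.
  rewrite mul1r mulrC ler_pdivlMr ?ltr0n // -natrX -natrM ler_nat.
  exact: leq_divM.
rewrite natrM; have [->|n_gt0] := posnP n; first by rewrite !mulr0.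
by rewrite expr2 mulrA divfK // pnatr_eq0 -lt0n.
Qed.
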